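(* Let $\Pi$ be the set of laws of a well-defined domain description over a finite non-empty action alphabet $\Sigma$, let $R$ be an answer set of $tr(\Pi)$, and let $\alpha$ be a DLTL formula over $\Sigma$. The temporal model $M_R=(\sigma,V)$ associated with $R$ satisfies $\alpha$ (i.e. $M_R,\varepsilon\models\alpha$) if and only if there is an answer set $R'$ of $tr'(\Pi)$ such that $R\subset R'$ and $sat(t_\alpha,0)\in R'$, where $t_\alpha$ is the term representing the formula $\alpha$ and the predicates $trans$ and $final$ encode the automata indexing the until formulas in $\alpha$.
   Context: **Literals and laws.** $\Sigma$ is a finite non-empty set of actions, $\mathcal{P}$ a set of fluent names (atomic propositions). A simple literal is $f$ or $\neg f$ with $f\in\mathcal{P}$. Temporal literals are $[a]l$ (with $a\in\Sigma$) and $\bigcirc l$, with $l$ a simple literal; in heads $l$ may also be $\bot$. ''$not$'' is default negation. A domain description over $\Sigma$ is a pair $D=(\Pi,\mathcal{C})$, where $\mathcal{C}$ is a set of DLTL formulas and $\Pi$ is a set of laws (rules) of the following forms, where $l_0$ is a simple literal or $\bot$: - action laws $\Box([a]l_0\leftarrow t_1,\dots,t_m,not\,t_{m+1},\dots,not\,t_n)$, each $t_i$ being a simple literal or of the form $[a]l$ (same $a$); - static causal laws $\Box(l_0\leftarrow l_1,\dots,l_m,not\,l_{m+1},\dots,not\,l_n)$, all $l_i$ ($i\ge1$) simple; - dynamic causal laws $\Box(\bigcirc l_0\leftarrow t_1,\dots,t_m,not\,t_{m+1},\dots,not\,t_n)$, each $t_i$ simple or of the form $\bigcirc l$; - initial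 state laws $l_0\leftarrow l_1,\dots,l_m,not\,l_{m+1},\dots,not\,l_n$ (no $\Box$), all $l_i$ ($i\ge 1$) simple. It is assumed that for each fluent $f$, $\Pi$ contains the initial state laws $f\leftarrow not\,\neg f$ and $\neg f\leftarrow not\,f$. **Temporal answer sets and well-definedness.** Let $\sigma\in\Sigma^\omega$. A partial temporal interpretation over $\sigma$ is a pair $(\sigma,S)$ where $S$ is a set of expressions $[a_1;\dots;a_k]l$ with $a_1\dots a_k$ a finite (possibly empty) prefix of $\sigma$ and $l$ a simple literal, such that $S$ never contains both $[a_1;\dots;a_k]f$ and $[a_1;\dots;a_k]\neg f$, nor $[a_1;\dots;a_k]\bot$. It is total if for every finite prefix $a_1\dots a_k$ of $\sigma$ and every $p\in\mathcal{P}$, $[a_1;\dots;a_k]p\in S$ or $[a_1;\dots;a_k]\neg p\in S$. Satisfaction at a prefix $\tau=a_1\dots a_k$ of $\sigma$: $(\sigma,S),\tau\not\models\bot$; $(\sigma,S),\tau\models l$ iff $[a_1;\dots;a_k]l\in S$ ($l$ simple); $(\sigma,S),\tau\models[a]l$ iff $[a_1;\dots;a_k;a]l\in S$ or $\tau a$ is not a prefix of $\sigma$; $(\sigma,S),\tau\models\bigcirc l$ iff $[a_1;\dots;a_k;b]l\in S$, where $\tau b$ is the prefix of $\sigma$ of length $k+1$; $(\sigma,S),\tau\models not\,t$ iff $(\sigma,S),\tau\not\models t$. A body is satisfied iff all its elements are. A rule $H\leftarrow B$ is satisfied in $(\sigma,S)$ if satisfaction of $B$ at the empty prefix $\varepsilon$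 implies satisfaction of $H$ at $\varepsilon$; $\Box(H\leftarrow B)$ is satisfied if this implication holds at every finite prefix of $\sigma$; $[a_1;\dots;a_h](H\leftarrow B)$ is satisfied if the implication holds at the prefix $a_1\dots a_h$. For a set $P$ of rules without default negation, $(\sigma,S)$ is a temporal answer set of $P$ if $S$ is $\subseteq$-minimal among the $S'$ such that $(\sigma,S')$ is a partial temporal interpretation satisfying the rules in $P$. For general $P$, the reduct $P^{(\sigma,S)}$ is the set of all rules $[a_1;\dots;a_h](H\leftarrow t_1,\dots,t_m)$ such that $a_1\dots a_h$ is a finite prefix of $\sigma$, $\Box(H\leftarrow t_1,\dots,t_m,not\,t_{m+1},\dots,not\,t_n)\in P$ and $(\sigma,S),a_1\dots a_h\not\models t_i$ for all $i=m+1,\dots,n$, together with, for each initial state law $H\leftarrow t_1,\dots,t_m,not\,t_{m+1},\dots,not\,t_n$ in $P$ with $(\sigma,S),\varepsilon\not\models t_i$ for $i=m+1,\dots,n$, the rule $H\leftarrow t_1,\dots,t_m$. $(\sigma,S)$ is a temporal answer set of $P$ if it is a temporal answer set of $P^{(\sigma,S)}$. $D=(\Pi,\mathcal{C})$ is well-defined if the temporal answer sets of $\Pi$ are total. **DLTL.** Programs: $\pi::=a\mid\pi_1+\pi_2\mid\pi_1;\pi_2\mid\pi^*$ ($a\in\Sigma$), i.e. regular expressions, with language $[[\pi]]\subseteq\Sigma^*$ defined as usual. Formulas: $p\mid\neg\alpha\mid\alpha\vee\beta\mid\alpha\,\mathcal{U}^\pi\beta$, with $p\in\mathcal{P}\cup\{\top,\bot\}$.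 A model is $M=(\sigma,V)$ with $\sigma\in\Sigma^\omega$ and $V$ mapping each finite prefix of $\sigma$ to a subset of $\mathcal{P}$. For a finite prefix $\tau$ of $\sigma$: $M,\tau\models\top$; $M,\tau\not\models\bot$; $M,\tau\models p$ iff $p\in V(\tau)$; $\neg,\vee$ as usual; $M,\tau\models\alpha\,\mathcal{U}^\pi\beta$ iff there is $\tau'\in[[\pi]]$ such that $\tau\tau'$ is a prefix of $\sigma$, $M,\tau\tau'\models\beta$, and $M,\tau\tau''\models\alpha$ for every proper prefix $\tau''$ of $\tau'$ (including $\varepsilon$ when $\tau'\neq\varepsilon$). Until formulas are assumed to be indexed by finite automata instead of programs: $\alpha\,\mathcal{U}^{\mathcal{A}(q)}\beta$ where $\mathcal{A}=(Q,\delta,Q_F)$ is an $\varepsilon$-free nondeterministic finite automaton over $\Sigma$, $\delta:Q\times\Sigma\to2^Q$, $Q_F$ the final states, $q\in Q$ the initial state, and the language of $\mathcal{A}(q)$ is $[[\pi]]$. **Translation $tr(\Pi)$.** Fix a bound $k\ge0$. $tr(\Pi)$ is the following (grounded) standard answer set program with classical negation $\neg$ and default negation $not$. States are the integers $0,\dots,k+1$ (predicate $state$); $action$ and $fluent$ are given by facts. For a simple literal $(\neg)f$, write $(\neg)holds(f,S)$ for its translation at $S$. The rules are: - for $S\in\{0,\dots,k\}$: $\neg occurs(A,S)\leftarrow occurs(A_1,S)$ for all actions $A\ne A_1$; and $occurs(A,S)\leftarrow not\,\neg occurs(A,S)$ for all actions $A$; - for each action law with head $[a](\neg)f_0$ and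 each $S\in\{0,\dots,k\}$: $(\neg)holds(f_0,S+1)\leftarrow occurs(a,S),h_1,\dots,h_m,not\,h_{m+1},\dots,not\,h_n$, where $h_i=(\neg)holds(f_i,S+1)$ if $t_i=[a](\neg)f_i$ and $h_i=(\neg)holds(f_i,S)$ if $t_i=(\neg)f_i$; - for each dynamic causal law with head $\bigcirc(\neg)f_0$ and each $S\in\{0,\dots,k\}$: $(\neg)holds(f_0,S+1)\leftarrow h_1,\dots,h_m,not\,h_{m+1},\dots,not\,h_n$, where $h_i=(\neg)holds(f_i,S+1)$ if $t_i=\bigcirc(\neg)f_i$ and $h_i=(\neg)holds(f_i,S)$ if $t_i=(\neg)f_i$; - static causal laws: the analogous rule with head and body all at state $S$, for each $S\in\{0,\dots,k+1\}$; initial state laws: the analogous rule at state $0$ only; - laws whose head literal is $\bot$ are translated in the same way to constraints (rules with empty head); - loop rules: $\mathit{diff\_last}(S)\leftarrow holds(F,S),\neg holds(F,k+1)$ and $\mathit{diff\_last}(S)\leftarrow holds(F,k+1),\neg holds(F,S)$ and $\mathit{eq\_last}(S)\leftarrow not\,\mathit{diff\_last}(S)$, for $0\le S\le k$ and fluents $F$; $next(S,S+1)$ for $0\le S<k$; $\neg next(k,S)\leftarrow next(k,S')$ for all states $S\neq S'$; $next(k,S)\leftarrow not\,\neg next(k,S)$ for $0\le S\le k$; and the constraint $\leftarrow next(k,S),not\,\mathit{eq\_last}(S)$. **Temporal model of an answer set $R$ of $tr(\Pi)$.** If $occurs(a_1,0),\dots,occurs(a_{k+1},k)$ and $next(k,j)$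 belong to $R$, then $M_R=(\sigma_R,V_R)$ with $\sigma_R=a_1\dots a_j(a_{j+1}\dots a_{k+1})^\omega$, and for $p\in\mathcal{P}$: $p\in V_R(\varepsilon)$ iff $holds(p,0)\in R$; $p\in V_R(a_1\dots a_h)$ iff $holds(p,h)\in R$ for $0<h\le k$; $p\in V_R(a_1\dots a_{k+1})$ iff $holds(p,j)\in R$; and so on periodically around the loop $j,\dots,k$. **$tr'(\Pi)$.** Formulas are represented by terms: fluents by themselves, $or(\cdot,\cdot)$, $neg(\cdot)$, and $until(A,q,t_\alpha,t_\beta)$ for $\alpha\,\mathcal{U}^{\mathcal{A}(q)}\beta$. Each automaton $\mathcal{A}=(Q,\delta,Q_F)$ indexing an until formula in $\alpha$ is described by the facts $trans(A,q_1,a,q_2)$ for $q_2\in\delta(q_1,a)$, and $final(A,q)$ for $q\in Q_F$. $tr'(\Pi)$ extends $tr(\Pi)$ with these facts and with the following rules, grounded over the states and over the (finitely many) subformulas of $\alpha$ and until formulas obtained from until subformulas $\gamma\,\mathcal{U}^{\mathcal{A}(q)}\beta$ by replacing $q$ with a state reachable from $q$ in $\mathcal{A}$: - $sat(true,S)$, where $true$ represents $\top$ (no rule for $\bot$); - $sat(F,S)\leftarrow fluent(F),holds(F,S)$; - $sat(or(X,Y),S)\leftarrow sat(X,S)$ and $sat(or(X,Y),S)\leftarrow sat(Y,S)$; - $sat(neg(X),S)\leftarrow not\,sat(X,S)$; - $sat(until(A,Q,X,Y),S)\leftarrow final(A,Q),sat(Y,S)$; - $sat(until(A,Q,X,Y),S)\leftarrow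 sat(X,S),trans(A,Q,Act,Q_1),occurs(Act,S),next(S,S_1),sat(until(A,Q_1,X,Y),S_1)$. *)

(* Defs.v *)
From Stdlib Require List.
From mathcomp Require Import all_boot.
From mathcomp Require Import boolp classical_sets.

Set Implicit Arguments.
Unset Strict Implicit.
Unset Printing Implicit Defensive.

Local Open Scope classical_set_scope.

Inductive literal (X : Type) : Type :=
| Pos of X
| Neg of X.

Definition consistent X (S : set (literal X)) : Prop :=
  forall x, ~ (S (Pos x) /\ S (Neg x)).

Definition subset_minimal T (F : set (set T)) (S : set T) : Prop :=
  F S /\ forall S', F S' -> S' `<=` S -> S' = S.

(* The head [None] is the empty head of a constraint. *)
Record asp_rule (X : Type) : Type := AspRule {
  asp_head : option (literal X);
  asp_pos : seq (literal X);
  asp_neg : seq (literal X) }.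

Definition asp_sat X (S : set (literal X)) (r : asp_rule X) : Prop :=
  List.Forall S (asp_pos r) ->
  if asp_head r is Some l then S l else False.

Definition asp_reduct X (P : set (asp_rule X)) (S : set (literal X)) :
    set (asp_rule X) :=
  [set r | exists2 r0, P r0 &
     List.Forall (fun l => ~ S l) (asp_neg r0) /\
     r = AspRule (asp_head r0) (asp_pos r0) [::] ].

(* Answer sets are consistent: the set of all literals never is one. *)
Definition answer_set X (P : set (asp_rule X)) (R : set (literal X)) : Prop :=
  subset_minimal
    [set S | consistent S /\ forall r, asp_reduct P R r -> asp_sat S r] R.

(* The finite prefix of length h of the infinite word sigma is
   [mkseq sigma h]. *)
Definition prefix_of (Sigma : finType) (sigma : nat -> Sigma)
  (tau : seq Sigma) : Prop := tau = mkseq sigma (size tau).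

Section DomainDescriptions.
Context (Sigma : finType) (P : Type).

(* A simple literal ([Some l]) or falsum ([None]). *)
Definition xliteral : Type := option (literal P).

(* Elements of the bodies of action and dynamic causal laws; [Nxt l] is read
   [a]l in an action law for a, and as (next l) in a dynamic causal law. *)
Inductive body_literal : Type :=
| Cur of literal P
| Nxt of literal P.

(* Each law lists its head l_0, the t_i occurring positively in its body and
   the t_i occurring under default negation. All laws but [InitialLaw] are
   prefixed by a box. *)
Inductive law : Type :=
| ActionLaw (a : Sigma) (l0 : xliteral) (pos neg : seq body_literal)
| StaticLaw (l0 : xliteral) (pos neg : seq (literal P))
| DynamicLaw (l0 : xliteral) (pos neg : seq body_literal)
| InitialLaw (l0 : xliteral) (pos neg : seq (literal P)).

Inductive temporal_literal : Type :=
| Simple of xliteral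
| After of Sigma & xliteral
| Next of xliteral.

Record rule : Type := Rule {
  head : temporal_literal;
  pos_body : seq temporal_literal;
  neg_body : seq temporal_literal }.

Definition simple_body (l : literal P) : temporal_literal := Simple (Some l).

Definition action_body (a : Sigma) (t : body_literal) : temporal_literal :=
  match t with Cur l => Simple (Some l) | Nxt l => After a (Some l) end.

Definition dynamic_body (t : body_literal) : temporal_literal :=
  match t with Cur l => Simple (Some l) | Nxt l => Next (Some l) end.

Definition law_rule (w : law) : rule :=
  match w with
  | ActionLaw a l0 pos neg =>
      Rule (After a l0) (map (action_body a) pos) (map (action_body a) neg)
  | StaticLaw l0 pos neg =>
      Rule (Simple l0) (map simple_body pos) (map simple_body neg)
  | DynamicLaw l0 pos neg =>
      Rule (Next l0) (map dynamic_body pos) (map dynamic_body neg)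
  | InitialLaw l0 pos neg =>
      Rule (Simple l0) (map simple_body pos) (map simple_body neg)
  end.

Definition boxed (w : law) : bool :=
  if w is InitialLaw _ _ _ then false else true.

(* The pair (tau, l) is the expression [a_1; ...; a_k]l with
   tau = a_1 ... a_k. As l is a simple literal, no [a_1; ...; a_k]falsum can
   occur in a set of such expressions. *)
Definition expression : Type := (seq Sigma * literal P)%type.

Definition partial_interpretation (sigma : nat -> Sigma)
    (S : set expression) : Prop :=
  (forall tau l, S (tau, l) -> prefix_of sigma tau) /\
  (forall tau f, ~ (S (tau, Pos f) /\ S (tau, Neg f))).

Definition total_interpretation (sigma : nat -> Sigma)
    (S : set expression) : Prop :=
  forall tau f, prefix_of sigma tau -> S (tau, Pos f) \/ S (tau, Neg f).

Definition expr_in (S : set expression) (tau : seq Sigma) (l : xliteral) :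
    Prop :=
  if l is Some l' then S (tau, l') else False.

Definition temporal_sat (sigma : nat -> Sigma) (S : set expression)
    (tau : seq Sigma) (t : temporal_literal) : Prop :=
  match t with
  | Simple l => expr_in S tau l
  | After a l => expr_in S (rcons tau a) l \/ ~ prefix_of sigma (rcons tau a)
  | Next l => expr_in S (rcons tau (sigma (size tau))) l
  end.

(* A rule [a_1; ...; a_h](H <- B) without default negation; the rules that
   stem from initial state laws are located at the empty prefix. *)
Record located_rule : Type := LocatedRule {
  location : seq Sigma;
  located_head : temporal_literal;
  located_body : seq temporal_literal }.

Definition located_sat (sigma : nat -> Sigma) (S : set expression)
    (r : located_rule) : Prop :=
  List.Forall (temporal_sat sigma S (location r)) (located_body r) ->
  temporal_sat sigma S (location r) (located_head r).

Definition reduct (Pi : set law) (sigma : nat -> Sigma) (S : set expression) :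
    set located_rule :=
  [set r | exists w tau,
     [/\ Pi w,
         prefix_of sigma tau,
         (~~ boxed w -> tau = [::]),
         List.Forall (fun t => ~ temporal_sat sigma S tau t)
                     (neg_body (law_rule w))
       & r = LocatedRule tau (head (law_rule w)) (pos_body (law_rule w))] ].

Definition temporal_answer_set (Pi : set law) (sigma : nat -> Sigma)
    (S : set expression) : Prop :=
  subset_minimal
    [set S' | partial_interpretation sigma S' /\
              forall r, reduct Pi sigma S r -> located_sat sigma S' r] S.

End DomainDescriptions.

Section DLTL.
Context (Sigma : finType) (P : Type).

Inductive program : Type :=
| Act of Sigma
| Choice of program & program
| Compose of program & program
| Star of program.

Fixpoint language (pi : program) : set (seq Sigma) :=
  match pi with
  | Act a => [set [:: a]]
  | Choice p1 p2 => language p1 `|` language p2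
  | Compose p1 p2 =>
      [set w | exists w1 w2,
         [/\ language p1 w1, language p2 w2 & w = w1 ++ w2] ]
  | Star p =>
      [set w | exists2 ws, List.Forall (language p) ws & w = flatten ws]
  end.

Inductive formula : Type :=
| FTop
| FBot
| FFluent of P
| FNeg of formula
| FOr of formula & formula
| FUntil of program & formula & formula.

(* Only the values of [val] at the finite prefixes of [word] matter. *)
Record model : Type := Model {
  word : nat -> Sigma;
  val : seq Sigma -> set P }.

Fixpoint satisfies (M : model) (tau : seq Sigma) (alpha : formula) : Prop :=
  match alpha with
  | FTop => True
  | FBot => False
  | FFluent p => val M tau p
  | FNeg b => ~ satisfies M tau b
  | FOr b c => satisfies M tau b \/ satisfies M tau c
  | FUntil pi b c =>
      exists tau', [/\ language pi tau',
        prefix_of (word M) (tau ++ tau'),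
        satisfies M (tau ++ tau') c
      & forall tau'', prefix tau'' tau' -> tau'' <> tau' ->
          satisfies M (tau ++ tau'') b]
  end.

Record domain_description : Type := DomainDescription {
  laws : set (law Sigma P);
  constraints : set formula }.

Definition complete_initial_state (D : domain_description) : Prop :=
  forall f : P,
    laws D (InitialLaw Sigma (Some (Pos f)) [::] [:: Neg f]) /\
    laws D (InitialLaw Sigma (Some (Neg f)) [::] [:: Pos f]).

Definition well_defined (D : domain_description) : Prop :=
  forall sigma S,
    temporal_answer_set (laws D) sigma S -> total_interpretation sigma S.

Record automaton : Type := Automaton {
  astate :> finType;
  delta : astate -> Sigma -> {set astate};
  final_states : {set astate} }.

Fixpoint accepts (A : automaton) (q : A) (w : seq Sigma) : Prop :=
  if w is a :: w' then exists2 q', q' \in delta q a & accepts q' w'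
  else q \in final_states A.

Definition reachable (A : automaton) (q q' : A) : bool :=
  connect (fun q1 q2 => [exists a, q2 \in delta q1 a]) q q'.

End DLTL.

(* Terms refer to automata by name; [aut] gives the automaton that a name
   stands for. *)
Section Terms.
Context (Sigma : finType) (P : Type) (Name : Type).
Context (aut : Name -> automaton Sigma).

Inductive term : Type :=
| TTrue
| TFalse
| TFluent of P
| TNeg of term
| TOr of term & term
| TUntil (A : Name) of aut A & term & term.

Arguments TUntil : clear implicits.

(* [represents t alpha]: t is a term t_alpha, each program pi of alpha being
   replaced by some pointed automaton A(q) whose language is that of pi. *)
Inductive represents : term -> formula Sigma P -> Prop :=
| rep_top : represents TTrue (FTop Sigma P)
| rep_bot : represents TFalse (FBot Sigma P)
| rep_fluent p : represents (TFluent p) (FFluent Sigma p)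
| rep_neg t b : represents t b -> represents (TNeg t) (FNeg b)
| rep_or t u b c :
    represents t b -> represents u c -> represents (TOr t u) (FOr b c)
| rep_until (A : Name) (q : aut A) pi t u b c :
    (forall w, accepts q w <-> language pi w) ->
    represents t b -> represents u c ->
    represents (TUntil A q t u) (FUntil pi b c).

Fixpoint subterm (t s : term) : Prop :=
  s = t \/
  match t with
  | TTrue | TFalse | TFluent _ => False
  | TNeg x => subterm x s
  | TOr x y | TUntil _ _ x y => subterm x s \/ subterm y s
  end.

(* The terms over which the rules for [sat] are grounded. *)
Definition grounding (t s : term) : Prop :=
  subterm t s \/
  exists (A : Name) (q q' : aut A) x y,
    [/\ subterm t (TUntil A q x y), reachable q q' & s = TUntil A q' x y].

Definition indexing_automaton (t : term) (A : Name) : Prop :=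
  exists (q : aut A) x y, subterm t (TUntil A q x y).

End Terms.

Arguments TUntil {Sigma P Name aut} A q t u.

Section Translation.
Context (Sigma : finType) (P : Type) (Name : Type).
Context (aut : Name -> automaton Sigma).

Inductive atom : Type :=
| State of nat
| Action of Sigma
| Fluent of P
| Occurs of Sigma & nat
| Holds of P & nat
| DiffLast of nat
| EqLast of nat
| NextState of nat & nat
| Trans (A : Name) of aut A & Sigma & aut A
| Final (A : Name) of aut A
| Sat of term P aut & nat.

Arguments Trans : clear implicits.
Arguments Final : clear implicits.

Definition holds_lit (s : nat) (l : literal P) : literal atom :=
  match l with Pos f => Pos (Holds f s) | Neg f => Neg (Holds f s) end.

Definition holds_body (s : nat) (t : body_literal P) : literal atom :=
  match t with Cur l => holds_lit s l | Nxt l => holds_lit s.+1 l end.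

Definition holds_head (s : nat) (l0 : xliteral P) : option (literal atom) :=
  omap (holds_lit s) l0.

Definition fact (x : atom) : asp_rule atom := AspRule (Some (Pos x)) [::] [::].

Definition rule_if (l : literal atom) (pos neg : seq (literal atom)) :
    asp_rule atom := AspRule (Some l) pos neg.

Definition constraint (pos neg : seq (literal atom)) : asp_rule atom :=
  AspRule None pos neg.

Inductive tr (k : nat) (Pi : set (law Sigma P)) : set (asp_rule atom) :=
| tr_state s : s <= k.+1 -> tr k Pi (fact (State s))
| tr_action a : tr k Pi (fact (Action a))
| tr_fluent f : tr k Pi (fact (Fluent f))
| tr_not_occurs s a a1 : s <= k -> a <> a1 ->
    tr k Pi (rule_if (Neg (Occurs a s)) [:: Pos (Occurs a1 s)] [::])
| tr_occurs s a : s <= k ->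
    tr k Pi (rule_if (Pos (Occurs a s)) [::] [:: Neg (Occurs a s)])
| tr_action_law s a l0 pos neg : s <= k -> Pi (ActionLaw a l0 pos neg) ->
    tr k Pi (AspRule (holds_head s.+1 l0)
                     (Pos (Occurs a s) :: map (holds_body s) pos)
                     (map (holds_body s) neg))
| tr_dynamic_law s l0 pos neg : s <= k -> Pi (DynamicLaw Sigma l0 pos neg) ->
    tr k Pi (AspRule (holds_head s.+1 l0)
                     (map (holds_body s) pos) (map (holds_body s) neg))
| tr_static_law s l0 pos neg : s <= k.+1 -> Pi (StaticLaw Sigma l0 pos neg) ->
    tr k Pi (AspRule (holds_head s l0)
                     (map (holds_lit s) pos) (map (holds_lit s) neg))
| tr_initial_law l0 pos neg : Pi (InitialLaw Sigma l0 pos neg) ->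
    tr k Pi (AspRule (holds_head 0 l0)
                     (map (holds_lit 0) pos) (map (holds_lit 0) neg))
| tr_diff_last1 s f : s <= k ->
    tr k Pi (rule_if (Pos (DiffLast s))
                     [:: Pos (Holds f s); Neg (Holds f k.+1)] [::])
| tr_diff_last2 s f : s <= k ->
    tr k Pi (rule_if (Pos (DiffLast s))
                     [:: Pos (Holds f k.+1); Neg (Holds f s)] [::])
| tr_eq_last s : s <= k ->
    tr k Pi (rule_if (Pos (EqLast s)) [::] [:: Pos (DiffLast s)])
| tr_next s : s < k -> tr k Pi (fact (NextState s s.+1))
| tr_not_next s s' : s <= k.+1 -> s' <= k.+1 -> s <> s' ->
    tr k Pi (rule_if (Neg (NextState k s)) [:: Pos (NextState k s')] [::])
| tr_next_last s : s <= k ->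
    tr k Pi (rule_if (Pos (NextState k s)) [::] [:: Neg (NextState k s)])
| tr_loop s : s <= k.+1 ->
    tr k Pi (constraint [:: Pos (NextState k s)] [:: Pos (EqLast s)]).

Inductive tr' (k : nat) (Pi : set (law Sigma P)) (t : term P aut) :
    set (asp_rule atom) :=
| tr'_tr r : tr k Pi r -> tr' k Pi t r
| tr'_trans (A : Name) (q1 q2 : aut A) a :
    indexing_automaton t A -> q2 \in delta q1 a ->
    tr' k Pi t (fact (Trans A q1 a q2))
| tr'_final (A : Name) (q : aut A) :
    indexing_automaton t A -> q \in final_states (aut A) ->
    tr' k Pi t (fact (Final A q))
| tr'_true s : s <= k.+1 -> grounding t (TTrue P aut) ->
    tr' k Pi t (fact (Sat (TTrue P aut) s))
| tr'_fluent s f : s <= k.+1 -> grounding t (TFluent aut f) ->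
    tr' k Pi t (rule_if (Pos (Sat (TFluent aut f) s))
                        [:: Pos (Fluent f); Pos (Holds f s)] [::])
| tr'_or_left s x y : s <= k.+1 -> grounding t (TOr x y) ->
    tr' k Pi t (rule_if (Pos (Sat (TOr x y) s)) [:: Pos (Sat x s)] [::])
| tr'_or_right s x y : s <= k.+1 -> grounding t (TOr x y) ->
    tr' k Pi t (rule_if (Pos (Sat (TOr x y) s)) [:: Pos (Sat y s)] [::])
| tr'_neg s x : s <= k.+1 -> grounding t (TNeg x) ->
    tr' k Pi t (rule_if (Pos (Sat (TNeg x) s)) [::] [:: Pos (Sat x s)])
| tr'_until_now s (A : Name) (q : aut A) x y : s <= k.+1 ->
    grounding t (TUntil A q x y) ->
    tr' k Pi t (rule_if (Pos (Sat (TUntil A q x y) s))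
                        [:: Pos (Final A q); Pos (Sat y s)] [::])
| tr'_until_next s s1 (A : Name) (q q1 : aut A) x y a :
    s <= k.+1 -> s1 <= k.+1 ->
    grounding t (TUntil A q x y) -> grounding t (TUntil A q1 x y) ->
    tr' k Pi t (rule_if (Pos (Sat (TUntil A q x y) s))
                        [:: Pos (Sat x s); Pos (Trans A q a q1);
                            Pos (Occurs a s); Pos (NextState s s1);
                            Pos (Sat (TUntil A q1 x y) s1)] [::]).

(* For an answer set R of tr(Pi), exactly one action occurs at each state
   s <= k, and exactly one state follows state k: these are picked here, and
   the defaults a0 and 0 of [xget] are not used. *)
Definition action_at (a0 : Sigma) (R : set (literal atom)) (s : nat) : Sigma :=
  xget a0 [set a | R (Pos (Occurs a s))].

Definition loop_state (k : nat) (R : set (literal atom)) : nat :=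
  xget 0 [set j | R (Pos (NextState k j))].

(* The state (at most k) of the lasso 0, ..., j, ..., k, j, ... reached
   after h steps. *)
Definition lasso (k j h : nat) : nat :=
  if h <= k then h else j + (h - j) %% (k.+1 - j).

Definition temporal_model (a0 : Sigma) (k : nat) (R : set (literal atom)) :
    model Sigma P :=
  let j := loop_state k R in
  Model (fun h => action_at a0 R (lasso k j h))
        (fun tau => [set p | R (Pos (Holds p (lasso k j (size tau))))]).

End Translation.

Arguments Trans {Sigma P Name aut} A q1 a q2.
Arguments Final {Sigma P Name aut} A q.

(* Main.v *)
(** Only the states 0, ..., k matter to [M_R], and along them [R] determines a
    lasso: exactly one action occurs at each state and exactly one state
    follows [k]. Reading a term directly on the states of this lasso, with
    until as a least fixed point, gives a semantics [sem] that agrees with the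
    unravelled model. The atoms [sat] are stratified by the size of terms: in
    an answer set of tr'(Pi) that contains [R], the atoms of a given size are
    the least set closed under their rules once the smaller ones are known, so
    they are exactly those true under [sem]; conversely, adding to [R] the
    atoms true under [sem] and the facts on automata gives an answer set of
    tr'(Pi). *)
Require Import Defs.
From mathcomp Require Import all_boot.
From mathcomp Require Import boolp classical_sets.

Set Implicit Arguments.
Unset Strict Implicit.
Unset Printing Implicit Defensive.

Local Open Scope classical_set_scope.

(** Minimality becomes induction: [R] intersected with [Q] is again a consistent model of the
    reduct, hence all of [R]. Constraints survive the intersection because their bodies already fail
    in [R]. *)
Lemma answer_set_ind X (P : set (asp_rule X)) (R Q : set (literal X)) :
  answer_set P R ->
  (forall r l, P r -> List.Forall (fun x => ~ R x) (asp_neg r) ->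
     asp_head r = Some l -> List.Forall R (asp_pos r) ->
     List.Forall Q (asp_pos r) -> Q l) ->
  R `<=` Q.
Proof.
move=> [[cR satR] minR] closedQ.
suff <- : R `&` Q = R by move=> l [].
apply: minR; last by move=> l [].
split=> [x [[Rp _] [Rn _]]|_ [r Pr [negR ->]]]; first exact: (cR x).
move=> /= /List.Forall_and_inv[posR posQ].
have := satR _ (ex_intro2 _ _ r Pr (conj negR erefl)) posR => /=.
case head_r: (asp_head r) => [l|//] Rl; split=> //.
exact: closedQ Pr negR head_r posR posQ.
Qed.

Lemma answer_set_closed X (P : set (asp_rule X)) R r :
  answer_set P R -> P r -> List.Forall (fun x => ~ R x) (asp_neg r) ->
  asp_sat R r.
Proof.
move=> [[_ satR] _] Pr negR.
exact: (satR _ (ex_intro2 _ _ r Pr (conj negR erefl))).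
Qed.

(** * Steps along the lasso and prefixes of an infinite word *)

Lemma lassoS k j h : j <= k ->
  lasso k j h.+1 = if lasso k j h < k then (lasso k j h).+1 else j.
Proof.
move=> le_jk; rewrite /lasso; case: (ltngtP h k) => [lt_hk|lt_kh|->].
- by rewrite lt_hk.
- have le_jh : j <= h by apply: leq_trans le_jk (ltnW lt_kh).
  rewrite subSn // modnS (subSn le_jk).
  have := ltn_pmod (h - j) (ltn0Sn (k - j)).
  have := divn_eq (h - j) (k - j).+1.
  set m := _ %% _; set d := _ %/ _ => hE; rewrite ltnS => le_m.
  (* The residue modulo the loop length [k.+1 - j] wraps to 0 exactly when [m] is [k - j], that is,
     when the lasso is at state [k]. *)
  case: ifPn => [dvd|ndvd].
    suff -> : m = k - j by rewrite subnKC // ltnn addn0.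
    apply/eqP; rewrite eqn_leq le_m /= leqNgt; apply/negP => lt_m.
    move: dvd; rewrite hE -addnS dvdn_addr ?dvdn_mull //.
    by move/dvdn_leq => /(_ isT); rewrite ltnS leqNgt lt_m.
  have lt_m : m < k - j.
    rewrite ltn_neqAle le_m andbT; apply: contraNneq ndvd => mE.
    by rewrite hE mE -addnS -mulSnr dvdn_mull.
  by rewrite -ltn_subRL lt_m addnS.
- by rewrite ltnn subSn // modnn addn0.
Qed.

Lemma lasso_le k j h : j <= k -> lasso k j h <= k.
Proof.
move=> le_jk; elim: h => [|h IH]; first by rewrite /lasso leq0n.
by rewrite lassoS //; case: ifP.
Qed.

Lemma prefix_of_rcons (Sigma : finType) (sigma : nat -> Sigma) tau a :
  prefix_of sigma (rcons tau a) <-> prefix_of sigma tau /\ a = sigma (size tau).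
Proof.
rewrite /prefix_of size_rcons mkseqS; split=> [/rcons_inj[? ?]|[-> ->]] //.
by rewrite size_mkseq.
Qed.

Lemma prefix_of_catl (Sigma : finType) (sigma : nat -> Sigma) tau tau' :
  prefix_of sigma (tau ++ tau') -> prefix_of sigma tau.
Proof.
elim/last_ind: tau' => [|w a IH]; first by rewrite cats0.
by rewrite -rcons_cat => /prefix_of_rcons[/IH].
Qed.

(** * Terms, their grounding and their semantics on states *)

Section Terms.
Context (Sigma : finType) (P Name : Type) (aut : Name -> automaton Sigma).
Arguments TTrue {Sigma P Name aut}.
Arguments TFluent {Sigma P Name aut}.
Arguments Fluent {Sigma P Name aut}.
Arguments Occurs {Sigma P Name aut}.
Arguments Holds {Sigma P Name aut}.
Arguments NextState {Sigma P Name aut}.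
Implicit Types (R : set (literal (atom P aut))) (t u x y : term P aut).

(** The stratum of a term. Automaton states do not count: the terms [TUntil A q x y], which call one
    another as [q] varies, share a stratum. *)
Fixpoint tsize u : nat :=
  match u with
  | TTrue | TFalse | TFluent _ => 0
  | TNeg x => (tsize x).+1
  | TOr x y | TUntil _ _ x y => (tsize x + tsize y).+1
  end.

Lemma subterm_refl t : subterm t t.
Proof. by case: t => *; left. Qed.

Lemma subterm_trans t u x : subterm t u -> subterm u x -> subterm t x.
Proof.
elim: t => [||p|y IHy|y IHy z IHz|A q y IHy z IHz] /=.
- by case=> [->|[]].
- by case=> [->|[]].
- by case=> [->|[]].
- by case=> [->//|/IHy sub /sub]; right.
- by case=> [->//|[/IHy sub /sub|/IHz sub /sub]]; right; [left|right].
- by case=> [->//|[/IHy sub /sub|/IHz sub /sub]]; right; [left|right].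
Qed.

Lemma grounding_neg t x : grounding t (TNeg x) -> grounding t x.
Proof.
move=> [sub|[A [q [q' [y [z []]]]]]] //; left; apply: subterm_trans sub _.
by right; apply: subterm_refl.
Qed.

Lemma grounding_or t x y :
  grounding t (TOr x y) -> grounding t x /\ grounding t y.
Proof.
move=> [sub|[A [q [q' [v [z []]]]]]] //.
by split; left; apply: subterm_trans sub _; right;
   [left|right]; apply: subterm_refl.
Qed.

Lemma grounding_until t A (q : aut A) x y : grounding t (TUntil A q x y) ->
  exists2 q0, subterm t (TUntil A q0 x y) & reachable q0 q.
Proof.
case=> [sub|[B [q0 [q' [v [z [sub rch E]]]]]]].
  by exists q => //; apply: connect0.
(* The type of [q] depends on [A]; rewriting [Q] with [E] avoids inverting a dependent equality. *)
pose Q w := if w is TUntil A q x y then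
  exists2 q0, subterm t (TUntil A q0 x y) & reachable q0 q else True.
suff : Q (TUntil A q x y) by [].
by rewrite E; exists q0.
Qed.

Lemma grounding_until_sub t A (q : aut A) x y : grounding t (TUntil A q x y) ->
  [/\ indexing_automaton t A, grounding t x & grounding t y].
Proof.
case/grounding_until=> q0 sub _; split; first by exists q0, x, y.
- by left; apply: subterm_trans sub _; right; left; apply: subterm_refl.
- by left; apply: subterm_trans sub _; right; right; apply: subterm_refl.
Qed.

Lemma grounding_until_next t A (q q1 : aut A) a x y :
  q1 \in delta q a -> grounding t (TUntil A q x y) ->
  grounding t (TUntil A q1 x y).
Proof.
move=> q1P /grounding_until[q0 sub rch]; right; exists A, q0, q1, x, y.
split=> //; apply: connect_trans rch (connect1 _).
by apply/existsP; exists a.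
Qed.

(** Being inductive matters on a cyclic lasso: each derivation is a finite path, so no until formula
    supports itself around the loop. *)
Inductive until_at R (A : Name) (X Y : nat -> Prop) : aut A -> nat -> Prop :=
| until_now (q : aut A) s : q \in final_states (aut A) -> Y s -> until_at R X Y q s
| until_next (q q1 : aut A) a s s1 : X s -> q1 \in delta q a -> R (Pos (Occurs a s)) ->
    R (Pos (NextState s s1)) -> until_at R X Y q1 s1 -> until_at R X Y q s.

Fixpoint sem R u (s : nat) : Prop :=
  match u with
  | TTrue => True
  | TFalse => False
  | TFluent p => R (Pos (Holds p s))
  | TNeg x => ~ sem R x s
  | TOr x y => sem R x s \/ sem R y s
  | TUntil A q x y => until_at R (sem R x) (sem R y) q s
  end.

(** A splitting set for [tr']: rules of [tr] mention only these literals, and the heads of all rules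
    added by [tr'] lie outside. *)
Definition in_tr_language (l : literal (atom P aut)) : bool :=
  match l with
  | Pos (Trans _ _ _ _) | Pos (Final _ _) | Pos (Sat _ _)
  | Neg (Trans _ _ _ _) | Neg (Final _ _) | Neg (Sat _ _) => false
  | _ => true
  end.

Lemma tr_language k Pi (r : asp_rule (atom P aut)) : tr k Pi r ->
  [/\ if asp_head r is Some l then in_tr_language l else True,
      List.Forall in_tr_language (asp_pos r)
    & List.Forall in_tr_language (asp_neg r)].
Proof.
have litP s (l : literal P) : in_tr_language (holds_lit aut s l) by case: l.
have litsP s (ls : seq (literal P)) :
    List.Forall in_tr_language (map (holds_lit aut s) ls).
  by elim: ls => [|l ls IH] /=; constructor.
have bodyP s (ls : seq (body_literal P)) :
    List.Forall in_tr_language (map (holds_body aut s) ls).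
  by elim: ls => [|[] l ls IH] /=; constructor=> //=.
case=> *; split=> //=;
  try match goal with |- context [holds_head _ _ ?l0] => by destruct l0 => /= end.
all: repeat first [exact: litsP | exact: bodyP | done
  | apply: List.Forall_nil | apply: List.Forall_cons].
Qed.

(** * Actions and successor states in an answer set of [tr] *)

Section AnswerSets.
Context (k : nat) (Pi : set (law Sigma P)) (R : set (literal (atom P aut)))
  (R_answer : answer_set (tr k Pi) R).

Lemma answer_set_language l : R l -> in_tr_language l.
Proof.
move: l; apply: (answer_set_ind R_answer) => r l /tr_language[+ _ _] _ E _ _.
by rewrite E.
Qed.

(** Each literal of [R] is the head of a rule whose body holds in [R]; the cases list what such a
    rule can be. *)
Lemma answer_set_supported l : R l ->
  match l with
  | Pos (NextState s s1) => if s < k then s1 = s.+1 else s = k /\ s1 <= k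
  | Neg (NextState _ s) => exists2 s1, s <> s1 & R (Pos (NextState k s1))
  | Neg (Occurs a s) => exists2 a1, a <> a1 & R (Pos (Occurs a1 s))
  | _ => True
  end.
Proof.
have headP s (l0 : xliteral P) l' : holds_head aut s l0 = Some l' ->
    exists f, l' = Pos (Holds f s) \/ l' = Neg (Holds f s).
  by case: l0 => [[f|f]|] //= [<-]; exists f; [left|right].
move: l; apply: (answer_set_ind R_answer) => r l [] /=.
- by move=> ? _ _ [<-].
- by move=> ? _ [<-].
- by move=> ? _ [<-].
- by move=> s a a1 _ a_a1 _ [<-] /List.Forall_cons_iff[? _] _; exists a1.
- by move=> ? ? _ _ [<-].
- by move=> s a l0 ? ? _ _ _ /headP[f [->|->]].
- by move=> s l0 ? ? _ _ _ /headP[f [->|->]].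
- by move=> s l0 ? ? _ _ _ /headP[f [->|->]].
- by move=> l0 ? ? _ _ /headP[f [->|->]].
- by move=> ? ? _ _ [<-].
- by move=> ? ? _ _ [<-].
- by move=> ? _ _ [<-].
- by move=> s lt_sk _ [<-]; rewrite lt_sk.
- by move=> s s' _ _ neq _ [<-] /List.Forall_cons_iff[? _] _; exists s'.
- by move=> s le_sk _ [<-]; rewrite ltnn.
- by [].
Qed.

Lemma next_state_le s s1 : R (Pos (NextState s s1)) -> s <= k /\ s1 <= k.
Proof.
move/answer_set_supported; case: ltnP => [lt_sk ->|_ [-> ?]] //.
by rewrite ltnW.
Qed.

(** If no action occurred at [s], nothing would support [Neg (Occurs a0 s)], and the default rule
    would make [a0] occur. *)
Lemma action_exists s : Sigma -> s <= k -> exists a, R (Pos (Occurs a s)).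
Proof.
move=> a0 le_sk; apply: contrapT => none; apply: (none); exists a0.
apply: (answer_set_closed R_answer (tr_occurs aut Pi a0 le_sk)) => //.
apply/List.Forall_cons_iff; split=> // /answer_set_supported[a1 _ Ra1].
by apply: none; exists a1.
Qed.

Lemma action_unique s a a1 : s <= k ->
  R (Pos (Occurs a s)) -> R (Pos (Occurs a1 s)) -> a = a1.
Proof.
move=> le_sk Ra Ra1; apply: contrapT => neq; apply: (R_answer.1.1 (Occurs a s)).
split=> //; apply: (answer_set_closed R_answer (tr_not_occurs aut Pi le_sk neq)).
  exact: List.Forall_nil.
by apply/List.Forall_cons_iff.
Qed.

Lemma loop_exists : exists j, R (Pos (NextState k j)).
Proof.
apply: contrapT => none; apply: (none); exists 0.
apply: (answer_set_closed R_answer (tr_next_last aut Pi (leq0n k))) => //.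
apply/List.Forall_cons_iff; split=> // /answer_set_supported[j _ Rj].
by apply: none; exists j.
Qed.

Lemma loop_unique i j :
  R (Pos (NextState k i)) -> R (Pos (NextState k j)) -> i = j.
Proof.
move=> Ri Rj; apply: contrapT => neq.
have [_ /leqW le_i] := next_state_le Ri.
have [_ /leqW le_j] := next_state_le Rj.
apply: (R_answer.1.1 (NextState k i)); split=> //.
apply: (answer_set_closed R_answer (tr_not_next aut Pi le_i le_j neq)).
  exact: List.Forall_nil.
by apply/List.Forall_cons_iff.
Qed.

Lemma loop_stateP : R (Pos (NextState k (loop_state k R))).
Proof. by have [j Rj] := loop_exists; exact: (@xgetI _ 0 [set j | R _] j Rj). Qed.

Lemma loop_state_le : loop_state k R <= k.
Proof. by have [] := next_state_le loop_stateP. Qed.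

Lemma action_atP a0 s : s <= k -> R (Pos (Occurs (action_at a0 R s) s)).
Proof.
move=> le_sk; have [a Ra] := action_exists a0 le_sk.
exact: (@xgetI _ a0 [set a | R _] a Ra).
Qed.

(** Below [k] successors are given by facts; at [k] the successor exists and is unique, so it is the
    loop state. *)
Lemma next_state_lasso h s : let j := loop_state k R in
  R (Pos (NextState (lasso k j h) s)) <-> s = lasso k j h.+1.
Proof.
move=> j; rewrite (lassoS _ loop_state_le); split=> [Rs|->].
  have := answer_set_supported Rs; case: ifP => // _ [E _].
  by apply: loop_unique loop_stateP; rewrite -E.
case: ifPn => [lt_k|]; last first.
  rewrite -leqNgt => le_k; have -> : lasso k j h = k; last exact: loop_stateP.
  by apply/eqP; rewrite eqn_leq le_k lasso_le // loop_state_le.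
exact: (answer_set_closed R_answer (tr_next aut Pi lt_k)).
Qed.

(** For until, an accepted word is read letter by letter as a derivation of [until_at], and
    conversely. *)
Lemma satisfies_sem a0 t alpha tau : represents t alpha ->
  prefix_of (word (temporal_model a0 k R)) tau ->
  satisfies (temporal_model a0 k R) tau alpha <->
  sem R t (lasso k (loop_state k R) (size tau)).
Proof.
set M := temporal_model a0 k R; set j := loop_state k R => rep.
have le_lasso h : lasso k j h <= k by apply/lasso_le/loop_state_le.
elim: rep tau => {t alpha} //=.
- by move=> t b _ IH tau /IH ->.
- by move=> t u b c _ IHb _ IHc tau tauP; rewrite IHb // IHc.
move=> A q pi t u b c accP _ IHb _ IHc tau tauP.
(* Trading the program for acceptance lets the induction on the word move to another automaton
   state. *)
transitivity (exists w, [/\ accepts q w, prefix_of (word M) (tau ++ w),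
    satisfies M (tau ++ w) c
  & forall v, prefix v w -> v <> w -> satisfies M (tau ++ v) b]).
  by split=> -[w [/accP ? ? ? ?]]; exists w.
clear accP pi; split.
- move=> [w]; elim: w q tau tauP => [|a w IHw] q tau tauP /= [].
    rewrite cats0 => qF _ /IHc sem_u _; apply: until_now => //; exact: sem_u.
  move=> [q1 q1P accw] pfx sat_c sat_b.
  move: pfx sat_c; rewrite -cat_rcons => pfx sat_c.
  have pfxa := prefix_of_catl pfx; have [_ aE] := (prefix_of_rcons _ _ _).1 pfxa.
  apply: (until_next (q1 := q1) (a := a) (s1 := lasso k j (size tau).+1)) => //.
  + by apply/IHb => //; rewrite -[tau]cats0; apply: sat_b.
  + by rewrite aE; apply: action_atP.
  + exact/next_state_lasso.
  + rewrite -(size_rcons tau a); apply: IHw => //; split=> // v vw neq.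
    rewrite cat_rcons; apply: sat_b => [|[]//].
    by rewrite /= eqxx.
- move sE: (lasso _ _ _) => s U; elim: U tau tauP sE => {q s}.
    move=> q s qF sem_u tau tauP sE; exists [::]; split=> //=.
    + by rewrite cats0.
    + by rewrite cats0; apply/IHc => //; rewrite sE.
    + by case.
  move=> q q1 a s s1 sem_t q1P Ra Rs1 _ IH tau tauP sE.
  (* The derivation has no freedom here: its successor state is the next one on the lasso, and its
     action is the next letter of the word. *)
  subst s; move/next_state_lasso in Rs1; subst s1.
  have pfxa : prefix_of (word M) (rcons tau a).
    apply/prefix_of_rcons; split=> //.
    exact: action_unique (le_lasso _) Ra (action_atP a0 (le_lasso _)).
  have [|w [accw pfx sat_c sat_b]] := IH _ pfxa; first by rewrite size_rcons.
  exists (a :: w); rewrite -cat_rcons; split=> //=; first by exists q1.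
  move=> [_ _|a' v]; first by rewrite cats0; apply/IHb.
  rewrite /=; case: eqP => //= -> vw neq; rewrite -cat_rcons.
  by apply: sat_b => // vE; apply: neq; rewrite vE.
Qed.

(** * Answer sets of [tr'] that extend [R] *)

Section Expansion.
Context (t : term P aut).

(* The atoms [sat] of size at least [n] are left unconstrained, so that the
   rules preserve this set as soon as the smaller atoms [sat] are known. The
   intersection over [n] is the intended answer set. *)
Definition expansion (n : nat) : set (literal (atom P aut)) := fun l =>
  match l with
  | Pos (Trans A q1 a q2) => indexing_automaton t A /\ q2 \in delta q1 a
  | Pos (Final A q) => indexing_automaton t A /\ q \in final_states (aut A)
  | Pos (Sat u s) => tsize u < n -> [/\ s <= k.+1, grounding t u & sem R u s]
  | Neg (Trans _ _ _ _) | Neg (Final _ _) | Neg (Sat _ _) => False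
  | _ => R l
  end.

Lemma expansion_language n l : in_tr_language l -> expansion n l = R l.
Proof. by case: l => [[]|[]]. Qed.

Lemma Forall_language (S S' : set (literal (atom P aut))) ls :
  (forall l, in_tr_language l -> S l -> S' l) ->
  List.Forall in_tr_language ls -> List.Forall S ls -> List.Forall S' ls.
Proof.
move=> SS' lang Sls; apply: List.Forall_impl (List.Forall_and lang Sls).
by move=> l [] /SS'.
Qed.

(** [X] decides default negation. A head of size at most [n] negates only a [sat] atom of size below
    [n], where [X] is known to contain the true ones; larger heads hold trivially. *)
Lemma expansion_closed n X r : tr' k Pi t r -> R `<=` X ->
  (forall x s, s <= k.+1 -> grounding t x -> tsize x < n -> sem R x s ->
     X (Pos (Sat x s))) ->
  List.Forall (fun l => ~ X l) (asp_neg r) ->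
  asp_sat (expansion n.+1) r.
Proof.
rewrite /asp_sat => tr_r RX semX; case: tr_r => [{}r tr_r|A q1 q2 a|A q|s|s f|s x y|s x y
  |s x|s A q x y|s s1 A q q1 x y a] /=.
- have [langH langP langN] := tr_language tr_r => negX posE.
  have := answer_set_closed R_answer tr_r; rewrite /asp_sat.
  case: (asp_head r) langH => [l /expansion_language->|_]; apply.
  + by apply: List.Forall_impl negX => l' nXl /RX.
  + by apply: Forall_language langP posE => l' /expansion_language->.
  + by apply: List.Forall_impl negX => l' nXl /RX.
  + by apply: Forall_language langP posE => l' /expansion_language->.
- by [].
- by [].
- by [].
- by move=> le_s gr _ /List.Forall_cons_iff[_ /List.Forall_cons_iff[]].
- move=> le_s gr _ /List.Forall_cons_iff[Ex _] => lt_n.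
  have [|_ _ sem_x] := Ex; last by split=> //; left.
  exact: leq_ltn_trans (leq_addr _ _) (ltnW lt_n).
- move=> le_s gr _ /List.Forall_cons_iff[Ey _] => lt_n.
  have [|_ _ sem_y] := Ey; last by split=> //; right.
  exact: leq_ltn_trans (leq_addl _ _) (ltnW lt_n).
- move=> le_s gr /List.Forall_cons_iff[nX _] _ lt_n; split=> // sem_x.
  by apply: nX; apply: semX => //; apply: grounding_neg gr.
- move=> le_s gr _ /List.Forall_cons_iff[[_ qF] /List.Forall_cons_iff[Ey _]] lt_n.
  have [|_ _ sem_y] := Ey; last by split=> //; apply: until_now.
  exact: leq_ltn_trans (leq_addl _ _) (ltnW lt_n).
- move=> le_s le_s1 gr gr1 _ /List.Forall_cons_iff[Ex].
  move=> /List.Forall_cons_iff[[_ q1P] /List.Forall_cons_iff[/= Ra]].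
  move=> /List.Forall_cons_iff[/= Rs1 /List.Forall_cons_iff[Eu _]] lt_n.
  have [//|_ _ sem_u] := Eu.
  have [|_ _ sem_x] := Ex; last by split=> //; exact: until_next q1P Ra Rs1 sem_u.
  exact: leq_ltn_trans (leq_addr _ _) (ltnW lt_n).
Qed.

(** [X] decides negation while [S] collects consequences. They are kept apart so that [S] may be
    either the answer set itself or a smaller competitor for minimality. *)
Lemma sat_complete (X S : set (literal (atom P aut))) u :
  (forall r, tr' k Pi t r -> List.Forall (fun l => ~ X l) (asp_neg r) ->
     asp_sat S r) ->
  R `<=` S ->
  (forall x s, s <= k.+1 -> grounding t x -> tsize x < tsize u ->
     X (Pos (Sat x s)) -> sem R x s) ->
  forall s, s <= k.+1 -> grounding t u -> sem R u s -> S (Pos (Sat u s)).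
Proof.
move=> closedS RS.
elim: u => [||f|x _|x IHx y IHy|A q x IHx y IHy] Xsem s le_s gr.
- by move=> _; apply: (closedS _ (tr'_true Pi le_s gr)).
- by [].
- move=> Rf; apply: (closedS _ (tr'_fluent Pi le_s gr)) => //.
  apply: List.Forall_cons; last by apply: List.Forall_cons => //; apply: RS.
  by apply: RS; apply: (answer_set_closed R_answer (tr_fluent aut k Pi f)).
- move=> /= nsem; apply: (closedS _ (tr'_neg Pi le_s gr)) => //.
  by apply: List.Forall_cons => // /Xsem sem_x; apply: nsem; apply: sem_x => //;
     apply: grounding_neg gr.
- have [grx gry] := grounding_or gr; case=> sem_.
  + apply: (closedS _ (tr'_or_left Pi le_s gr)) => //; apply: List.Forall_cons => //.
    apply: IHx => // z s' le_s' grz lt_z; apply: Xsem => //=.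
    exact: leq_trans lt_z (leqW (leq_addr _ _)).
  + apply: (closedS _ (tr'_or_right Pi le_s gr)) => //; apply: List.Forall_cons => //.
    apply: IHy => // z s' le_s' grz lt_z; apply: Xsem => //=.
    exact: leq_trans lt_z (leqW (leq_addl _ _)).
- have [ind grx gry] := grounding_until_sub gr.
  have {}IHx s' : s' <= k.+1 -> sem R x s' -> S (Pos (Sat x s')).
    move=> le_s'; apply: IHx => // z s'' le_s'' grz lt_z; apply: Xsem => //=.
    exact: leq_trans lt_z (leqW (leq_addr _ _)).
  have {}IHy s' : s' <= k.+1 -> sem R y s' -> S (Pos (Sat y s')).
    move=> le_s'; apply: IHy => // z s'' le_s'' grz lt_z; apply: Xsem => //=.
    exact: leq_trans lt_z (leqW (leq_addl _ _)).
  (* The arguments being settled at every state, an inner induction on the derivation follows the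
     automaton around the lasso. *)
  move=> /= U; elim: U le_s gr {Xsem} => {q s}.
    move=> q s qF sem_y le_s gr.
    apply: (closedS _ (tr'_until_now Pi le_s gr)) => //.
    apply: List.Forall_cons; last by apply: List.Forall_cons => //; apply: IHy.
    exact: (closedS _ (tr'_final k Pi ind qF)).
  move=> q q1 a s s1 sem_x q1P Ra Rs1 _ IH le_s gr.
  have gr1 := grounding_until_next q1P gr.
  have [_ /leqW le_s1] := next_state_le Rs1.
  apply: (closedS _ (tr'_until_next Pi a le_s le_s1 gr gr1)) => //.
  apply: List.Forall_cons; first exact: IHx.
  apply: List.Forall_cons; first exact: (closedS _ (tr'_trans k Pi ind q1P)).
  by do 2 (apply: List.Forall_cons; first exact: RS); apply: List.Forall_cons => //; apply: IH.
Qed.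

(** Negation swaps the two directions, so both are proved together by induction on size: soundness
    uses completeness for smaller terms, and completeness uses soundness for them. *)
Lemma answer_set_sat R' u s : answer_set (tr' k Pi t) R' -> R `<=` R' ->
  s <= k.+1 -> grounding t u -> (R' (Pos (Sat u s)) <-> sem R u s).
Proof.
move=> R'_answer RR'; have [n] := ubnP (tsize u).
elim: n u s => // n IH u s lt_u le_s gr; split=> [|sem_u].
  suff /[apply] /(_ lt_u)[] : R' `<=` expansion n.+1 by [].
  apply: (answer_set_ind R'_answer) => r l tr_r negR' head_r _ posE.
  have := expansion_closed tr_r RR' _ negR'; rewrite /asp_sat head_r; apply=> //.
  by move=> x s' le_s' grx lt_x; apply: (IH x s' lt_x le_s' grx).2.
apply: (sat_complete (X := R')) => // [r|x s' le_s' grx lt_x].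
  exact: answer_set_closed R'_answer.
by apply: (IH x s' _ le_s' grx).1; apply: leq_trans lt_x lt_u.
Qed.

Lemma expansion_answer_set : answer_set (tr' k Pi t) (\bigcap_n expansion n).
Proof.
set W := \bigcap_n _.
have WE l : in_tr_language l -> W l = R l.
  move=> lang; apply/propext; split=> [/(_ 0 I)|Rl n _];
  by rewrite expansion_language.
have RW : R `<=` W by move=> l Rl; rewrite WE //; apply: answer_set_language.
have satW u s : W (Pos (Sat u s)) <-> [/\ s <= k.+1, grounding t u & sem R u s].
  by split=> [Wu|? n _ _ //]; apply: (Wu (tsize u).+1 I).
split; first split.
- move=> x [/(_ 0 I) Wp /(_ 0 I) Wn].
  have lang : in_tr_language (Neg x) by case: x Wn {Wp}.
  rewrite expansion_language // in Wn.
  rewrite expansion_language in Wp; last by case: (x) lang.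
  exact: R_answer.1.1 (conj Wp Wn).
- move=> _ [r tr_r [negW ->]] posW /=.
  have closed n : asp_sat (expansion n.+1) r.
    by apply: (expansion_closed tr_r RW) => // x s le_s gr _ ?; apply/satW.
  have {}posW n : List.Forall (expansion n) (asp_pos r).
    by apply: List.Forall_impl posW => l /(_ n I).
  move: closed; rewrite /asp_sat; case: (asp_head r) => [l El|/(_ 0)]; last exact.
  (* Closure yields the head at level [n.+1], and [expansion n.+1] is included in [expansion n], so
     level 0 is covered too. *)
  move=> n _; move: (El n (posW _)); case: l {El} => [[]|[]] //= u s Eu lt_u.
  exact/Eu/ltnW.
- move=> S [cS satS] SW; apply/seteqP; split=> //.
  have closedS r : tr' k Pi t r -> List.Forall (fun l => ~ W l) (asp_neg r) ->
      asp_sat S r.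
    by move=> tr_r negW; apply: (satS _ (ex_intro2 _ _ r tr_r (conj negW erefl))).
  have RS : R `<=` S.
    (* Restricted to the language of [tr], the competitor [S] is a model of the reduct of [tr] by
       [R], so minimality of [R] applies. *)
    suff <- : S `&` [set l | in_tr_language l] = R by move=> l [].
    apply: R_answer.2 => [|l [/SW + lang]]; last by rewrite WE.
    split=> [x [[Sp _] [Sn _]]|_ [r tr_r [negR ->]]]; first exact: (cS x).
    move=> /List.Forall_and_inv[posS _] /=.
    have [langH langP langN] := tr_language tr_r.
    have : asp_sat S r.
      apply: closedS (tr'_tr t tr_r) _.
      by apply: Forall_language langN negR => l lang; rewrite WE.
    by rewrite /asp_sat; case: (asp_head r) langH => [l langl|_] /(_ posS).
  move=> l /[dup] Wl /(_ 0 I); case: l Wl => [[]|[]] //=.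
  all: try by move=> *; apply: RS.
  + by move=> A q1 a q2 _ [ind q2P]; apply: (closedS _ (tr'_trans k Pi ind q2P)).
  + by move=> A q _ [ind qF]; apply: (closedS _ (tr'_final k Pi ind qF)).
  + move=> u s /satW[le_s gr sem_u] _; apply: (sat_complete closedS) => //.
    by move=> x s' _ _ _ /satW[].
Qed.

End Expansion.
End AnswerSets.
End Terms.

Theorem theorem2 (Sigma : finType) (a0 : Sigma) (P : Type)
    (D : domain_description Sigma P) (k : nat)
    (Name : Type) (aut : Name -> automaton Sigma)
    (R : set (literal (atom P aut)))
    (alpha : formula Sigma P) (t_alpha : term P aut)
    (D_init : complete_initial_state D) (D_wd : well_defined D)
    (R_answer : answer_set (tr k (laws D)) R)
    (t_alphaP : represents t_alpha alpha) :
  satisfies (temporal_model a0 k R) [::] alpha <->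
  exists R' : set (literal (atom P aut)),
    [/\ answer_set (tr' k (laws D) t_alpha) R',
        R `<` R'
      & R' (Pos (Sat t_alpha 0))].
Proof.
have gr : grounding t_alpha t_alpha by left; apply: subterm_refl.
rewrite (satisfies_sem (a0 := a0) (tau := [::]) R_answer t_alphaP) //.
rewrite /= {1}/lasso leq0n; split=> [sem_t|[R' [R'_answer [RR' _] Rt]]]; last first.
  exact/(answer_set_sat R_answer R'_answer).
pose W := \bigcap_n expansion k R t_alpha n.
have Wt : W (Pos (Sat t_alpha 0)) by move=> n _ _; split.
have RW : R `<=` W.
  move=> l Rl n _; rewrite expansion_language //.
  exact: answer_set_language R_answer _ Rl.
exists W; split=> //; first exact: expansion_answer_set.
(* The inclusion is strict because [Sat t_alpha 0] is in [W] but outside the language of [tr]. *)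
by split=> // /(_ _ Wt)/(answer_set_language R_answer).
Qed.
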